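(* Let $a<b$ be real numbers, let $\alpha\in(0,1)$, and set $\rho=\frac{1-\alpha}{\alpha}(b-a)$. Let $u$ and $w$ be real-valued, nonnegative and convex functions on $[a,b]$. Then both of the following inequalities hold: $$\frac{\alpha}{2(b-a)}\left[\mathcal{I}^\alpha_a(uw)(b)+\mathcal{I}^\alpha_b(uw)(a)\right]\leq \left[u(a)w(a)+u(b)w(b)\right]\frac{\rho^2-2\rho+4-(\rho^2+2\rho+4)\exp(-\rho)}{2\rho^3}+\left[u(a)w(b)+u(b)w(a)\right]\frac{\rho-2+\exp(-\rho)(\rho+2)}{\rho^3},$$ and $$2u\left(\frac{a+b}{2}\right)w\left(\frac{a+b}{2}\right)\leq \frac{1-\alpha}{2(1-\exp(-\rho))}\left[\mathcal{I}^{\alpha}_a(uw)(b)+\mathcal{I}^{\alpha}_b(uw)(a)\right]+\left[u(a)w(a)+u(b)w(b)\right]\frac{\rho-2+\exp(-\rho)(\rho+2)}{\rho^2(1-\exp(-\rho))}+\left[u(a)w(b)+u(b)w(a)\right]\frac{\rho^2-2\rho+4-(\rho^2+2\rho+4)\exp(-\rho)}{2\rho^2(1-\exp(-\rho))}.$$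
   Context: For $\alpha\in(0,1)$ and $f\in L_1(a,b)$, the fractional integrals with exponential kernel are defined by $$\mathcal{I}^\alpha_a f(x)=\frac{1}{\alpha}\int_a^x \exp\left(-\frac{1-\alpha}{\alpha}(x-s)\right)f(s)\,ds,\quad x>a,$$ $$\mathcal{I}^\alpha_b f(x)=\frac{1}{\alpha}\int_x^b \exp\left(-\frac{1-\alpha}{\alpha}(s-x)\right)f(s)\,ds,\quad x<b.$$ Here $uw$ denotes the pointwise product; $\mathcal{I}^\alpha_a f(b)$ is the first operator evaluated at $x=b$, and $\mathcal{I}^\alpha_b f(a)$ is the second evaluated at $x=a$. *)

(* Defs.v *)
From mathcomp Require Import all_boot all_order all_algebra.
From mathcomp Require Import all_classical all_reals all_analysis.

Set Implicit Arguments.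
Unset Strict Implicit.
Unset Printing Implicit Defensive.

Import Order.TTheory GRing.Theory Num.Theory.
Import numFieldNormedType.Exports.

Local Open Scope classical_set_scope.
Local Open Scope ring_scope.

(* Both operators are total in x; they are meaningful for a < x (resp. x < b)
   and for f Lebesgue integrable on the interval of integration. *)

Definition expfrac_left (R : realType) (alpha a : R) (f : R -> R) (x : R) : R :=
  1 / alpha * \int[lebesgue_measure]_(s in `[a, x])
                 (expR (- ((1 - alpha) / alpha) * (x - s)) * f s).

Definition expfrac_right (R : realType) (alpha b : R) (f : R -> R) (x : R) : R :=
  1 / alpha * \int[lebesgue_measure]_(s in `[x, b])
                 (expR (- ((1 - alpha) / alpha) * (s - x)) * f s).

(* Main.v *)
Require Import Defs.
From mathcomp Require Import all_boot all_order all_algebra.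
From mathcomp Require Import all_classical all_reals all_analysis.
From mathcomp Require Import measurable_realfun.
From mathcomp Require Import ring lra.
Import Order.TTheory GRing.Theory Num.Theory.
Import numFieldNormedType.Exports.
Local Open Scope classical_set_scope.
Local Open Scope ring_scope.

(** Reflecting [s] into [a + b - s] in one of the two integrals merges them into
    [alpha * (I_a (uw) b + I_b (uw) a) = int_a^b exp (- c (s - a)) G s ds] with
    [c = (1 - alpha) / alpha] and [G s = (uw) s + (uw) (a + b - s)]. With
    [t = (b - s) / (b - a)], convexity along the chords gives
    [G <= M + 2 (N - M) t (1 - t)] where [M = u a w a + u b w b] and
    [N = u a w b + u b w a]; expanding the product of
    [2 u m <= u s + u (a + b - s)] and [2 w m <= w s + w (a + b - s)] at the
    midpoint [m], and bounding the mixed terms by the chords, gives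
    [4 u m w m - N + 2 (N - M) t (1 - t) <= G]. Both bounds are quadratic in
    [s], so their integrals against the kernel are explicit. *)

(** * Chords and measurability of convex functions *)

Lemma convex_function_ler (R : realType) (a b : R) (f : R -> R) (x y t : R) :
  convex_function (`[a, b] : set R^o) f ->
  a <= x <= b -> a <= y <= b -> 0 <= t <= 1 ->
  f (t * x + (1 - t) * y) <= t * f x + (1 - t) * f y.
Proof.
move=> cf xab yab t01.
have := cf (Itv01 (proj1 (andP t01)) (proj2 (andP t01))) x y.
by rewrite !inE/= !in_itv/=; apply.
Qed.

Lemma convex_function_chord (R : realType) (a b : R) (f : R -> R) (x y z : R) :
  convex_function (`[a, b] : set R^o) f ->
  a <= x -> x < y -> y <= b -> x <= z <= y ->
  f z <= (y - z) / (y - x) * f x + (1 - (y - z) / (y - x)) * f y.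
Proof.
move=> cf ax xy yb /andP[xz zy].
have yx0 : 0 < y - x by rewrite subr_gt0.
have := @convex_function_ler R a b f x y ((y - z) / (y - x)) cf.
rewrite [_ * x + _](_ : _ = z); last by field; rewrite gt_eqF.
apply; [lra|lra|].
apply/andP; split; first by rewrite divr_ge0 ?subr_ge0// ltW.
by rewrite ler_pdivrMr// mul1r; lra.
Qed.

(* Sublevel sets of a convex function are intervals. *)
Lemma convex_function_measurable (R : realType) (a b : R) (f : R -> R) :
  convex_function (`[a, b] : set R^o) f -> measurable_fun `[a, b] f.
Proof.
move=> cf.
apply: (measurability (@RGenInftyO.G R)) => [|/= _ [_] [r] -> <-].
  exact: RGenInftyO.measurableE.
apply: is_interval_measurable => x y/=; rewrite !in_itv/=.
move=> [/andP[ax xb] fxr] [/andP[ay yb] fyr] z /andP[xz zy].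
split; first by rewrite in_itv/=; lra.
rewrite in_itv/=.
have := le_trans xz zy; rewrite le_eqVlt => /predU1P[xy|xy].
  by rewrite (_ : z = x)//; lra.
have yx0 : 0 < y - x by rewrite subr_gt0.
have xzy : x <= z <= y by rewrite xz.
apply: (le_lt_trans (convex_function_chord R a b f x y z cf ax xy yb xzy)).
set t := (_ / _).
have : 0 <= t by rewrite divr_ge0 ?subr_ge0// ltW.
have t1 : t <= 1 by rewrite ler_pdivrMr// mul1r; lra.
(* At [t = 0] the chord bound is [f y < r]; for [t > 0] the strict inequality [f x < r] enters with
   positive weight. *)
by rewrite le_eqVlt => /predU1P[<-|t0]; [lra|nra].
Qed.

(** * Reflection invariance of Lebesgue measure *)

Lemma measurable_reflect (R : realType) (c : R) :
  measurable_fun [set: measurableTypeR R]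
    ((fun x => c - x) : measurableTypeR R -> measurableTypeR R).
Proof.
apply: continuous_measurable_fun => x.
by apply: cvgB; [exact: cvg_cst|exact: cvg_id].
Qed.

(** Lebesgue measure is determined by the lengths of half-open intervals, and the preimage of []x,
    y]] is [[c - y, c - x[], of the same length. *)
Lemma lebesgue_measure_reflect (R : realType) (c : R) (A : set R) :
  measurable A ->
  lebesgue_measure A = pushforward lebesgue_measure (fun x : R => c - x) A.
Proof.
move=> mA.
(* The measure structure on a pushforward depends on the measurability of the
   map, which unification cannot supply, so the instance is named. *)
apply: (@lebesgue_measure_unique R
  (measure_function_pushforward__canonical__measure_function_Measure
    lebesgue_measure (measurable_reflect R c))) => //.
move=> _ [[x y] _ <-]/=.
rewrite /pushforward/=.
rewrite (_ : _ @^-1` `]x, y] = `[c - y, c - x[%classic); last first.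
  apply/seteqP; split => z /=; rewrite !in_itv/= => /andP[? ?]; lra.
rewrite !lebesgue_measure_itv/= !lte_fin ltrD2l ltrN2 -!EFinB.
by case: ifP => // _; congr (_%:E); ring.
Qed.

Lemma ge0_Rintegral_reflect (R : realType) (a b : R) (f : R -> R) :
  measurable_fun `[a, b] f -> (forall x, a <= x <= b -> 0 <= f x) ->
  \int[lebesgue_measure]_(x in `[a, b]) f x =
  \int[lebesgue_measure]_(x in `[a, b]) f (a + b - x).
Proof.
move=> mf f0; rewrite /Rintegral; congr fine.
pose nu := measure_function_pushforward__canonical__measure_function_Measure
  lebesgue_measure (measurable_reflect R (a + b)).
rewrite (@eq_measure_integral _ _ _ _ nu); last first.
  by move=> A mA _; exact: lebesgue_measure_reflect.
rewrite ge0_integral_pushforward//; last 3 first.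
- exact: measurable_reflect.
- exact/measurable_EFinP.
- by move=> y; rewrite inE/= in_itv/= lee_fin; exact: f0.
rewrite (_ : _ @^-1` _ = `[a, b]%classic)//.
apply/seteqP; split => z /=; rewrite !in_itv/= => /andP[? ?]; lra.
Qed.

(** * The kernel integrated against a quadratic *)

Lemma Rintegral_expR_quadratic (R : realType) (a b c A B : R) :
  a < b -> 0 < c ->
  let rho := c * (b - a) in
  \int[lebesgue_measure]_(s in `[a, b])
     (expR (- c * (s - a))
      * (A + B * ((s - a) / (b - a) * (1 - (s - a) / (b - a))))) =
  (b - a) * (A * ((1 - expR (- rho)) / rho)
             + B * ((rho - 2 + expR (- rho) * (rho + 2)) / rho ^+ 3)).
Proof.
move=> ab c0 rho.
have l0 : b - a != 0 by rewrite gt_eqF// subr_gt0.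
have c0' : c != 0 by rewrite gt_eqF.
pose f s := expR (- c * (s - a))
      * (A + B * ((s - a) / (b - a) * (1 - (s - a) / (b - a)))).
pose l := b - a.
(* For a quadratic p, an antiderivative of exp(- c x) p(x) is
   - exp(- c x) (p(x) / c + p'(x) / c^2 + p''(x) / c^3). *)
pose F s := - (expR (- c * (s - a)) *
   ((A + B * ((s - a) / l * (1 - (s - a) / l))) / c
    + B * (1 / l - 2 * (s - a) / l ^+ 2) / c ^+ 2
    - 2 * B / l ^+ 2 / c ^+ 3)).
have dF (s : R) : is_derive s (1 : R) F (f s).
  rewrite /F; apply: is_derive_eq.
  rewrite /f /l; set e := expR _.
  rewrite /GRing.scale/=.
  field.
  by rewrite c0' l0.
have cF : continuous F.
  by move=> x; apply/differentiable_continuous/derivable1_diffP; have [] := dF x.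
rewrite /Rintegral (@continuous_FTC2 _ f F a b)//.
- rewrite -EFinB/= /F /rho /l subrr mulr0 expR0 mulNr.
  set e := expR _.
  field.
  by rewrite c0' l0.
- apply: continuous_subspaceT => x.
  apply/differentiable_continuous/derivable1_diffP.
  by rewrite /f; apply: ex_derive.
- split => [x _||]; [by have [] := dF x| |].
  + exact: cvg_at_right_filter (cF a).
  + exact: cvg_at_left_filter (cF b).
- by move=> x _; rewrite derive1E; apply: derive_val.
Qed.

(** * Integrability and merging of the two operators *)

Lemma bounded_integrable_itv (R : realType) (a b K : R) (g : R -> R) :
  measurable_fun `[a, b] g -> (forall x, a <= x <= b -> `|g x| <= K) ->
  lebesgue_measure.-integrable `[a, b] (EFin \o g).
Proof.
move=> mg gK; apply: measurable_bounded_integrable => //.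
- rewrite /= lebesgue_measure_itv/=.
  by case: ifP => _; rewrite ?ltry// -EFinB ltry.
- exists K; split; first exact: num_real.
  move=> M KM x /=; rewrite in_itv/= => xab.
  exact: le_trans (gK _ xab) (ltW KM).
Qed.

Lemma measurable_fun_reflect (R : realType) (a b : R) (f : R -> R) :
  measurable_fun `[a, b] f ->
  measurable_fun `[a, b] (fun x => f (a + b - x)).
Proof.
move=> mf; apply: (measurable_comp _ _ mf) => //.
- by move=> _ [x /= + <-]; rewrite !in_itv/= => /andP[? ?]; lra.
- exact: measurable_funTS (measurable_reflect R (a + b)).
Qed.

Lemma measurable_expR_affine (R : realType) (D : set R) (c d : R) :
  measurable_fun D (fun s : R => expR (c * (s - d))).
Proof.
apply: measurable_funTS; apply: continuous_measurable_fun => s.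
apply/differentiable_continuous/derivable1_diffP.
by apply: ex_derive.
Qed.

(** For [c >= 0] the kernel is at most 1 on the interval, so the bound [K] on [g] survives the
    product. *)
Lemma integrable_expR_mul (R : realType) (a b c K : R) (g : R -> R) :
  0 <= c -> measurable_fun `[a, b] g -> (forall x, a <= x <= b -> `|g x| <= K) ->
  lebesgue_measure.-integrable `[a, b]
    (EFin \o (fun s => expR (- c * (s - a)) * g s)).
Proof.
move=> c0 mg gK; apply: (bounded_integrable_itv R a b K).
  by apply: measurable_funM => //; exact: measurable_expR_affine.
move=> x xab; rewrite normrM -[K]mul1r ler_pM//; last exact: gK.
rewrite ger0_norm ?expR_ge0// -expR0 ler_expR mulNr oppr_le0 mulr_ge0//; lra.
Qed.

(** The reflection carries the kernel of the left operator at [b] to that of the right operator at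
    [a]. The bound [K] makes both integrands integrable, so the integrals add. *)
Lemma expfrac_left_add_right (R : realType) (a b alpha K : R) (f : R -> R) :
  0 < alpha -> alpha <= 1 -> measurable_fun `[a, b] f ->
  (forall x, a <= x <= b -> 0 <= f x <= K) ->
  expfrac_left alpha a f b + expfrac_right alpha b f a =
  1 / alpha * \int[lebesgue_measure]_(s in `[a, b])
     (expR (- ((1 - alpha) / alpha) * (s - a)) * (f s + f (a + b - s))).
Proof.
move=> al0 al1 mf f0K.
have c0 : 0 <= (1 - alpha) / alpha by rewrite divr_ge0 ?subr_ge0 ?(ltW al0).
have fr x : a <= x <= b -> a <= a + b - x <= b by lra.
rewrite /expfrac_left /expfrac_right -mulrDr; congr (_ * _).
rewrite ge0_Rintegral_reflect; first last.
- move=> x xab; rewrite mulr_ge0 ?expR_ge0//.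
  by have /andP[] := f0K _ xab.
- apply: measurable_funM => //.
  rewrite (_ : (fun s => _) = fun s => expR ((1 - alpha) / alpha * (s - b))).
    exact: measurable_expR_affine.
  by apply/funext => s; congr expR; ring.
rewrite [X in X + _](_ : _ = \int[lebesgue_measure]_(s in `[a, b])
    (expR (- ((1 - alpha) / alpha) * (s - a)) * f (a + b - s))); last first.
  by apply: eq_Rintegral => s _; congr (expR (_ * _) * _); ring.
rewrite -RintegralD//; first last.
- apply: (@integrable_expR_mul _ _ _ _ K) => // x xab.
  by have /andP[? ?] := f0K _ xab; rewrite ger0_norm.
- apply: (@integrable_expR_mul _ _ _ _ K) => //.
    exact: measurable_fun_reflect.
  by move=> x /fr xab; have /andP[? ?] := f0K _ xab; rewrite ger0_norm.
by apply: eq_Rintegral => s _; ring.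
Qed.

(** * Pointwise bounds on the symmetrized product *)

(** Nonnegativity allows the chord bounds to be multiplied; then [t^2 + (1 - t)^2 = 1 - 2 t (1 - t)]
    collects the terms. *)
Lemma sum_mul_le_chord (R : realFieldType) (t ua ub wa wb u1 u2 w1 w2 : R) :
  0 <= u1 -> 0 <= u2 -> 0 <= w1 -> 0 <= w2 ->
  u1 <= t * ua + (1 - t) * ub -> u2 <= (1 - t) * ua + t * ub ->
  w1 <= t * wa + (1 - t) * wb -> w2 <= (1 - t) * wa + t * wb ->
  u1 * w1 + u2 * w2 <= ua * wa + ub * wb
    + 2 * (ua * wb + ub * wa - (ua * wa + ub * wb)) * (t * (1 - t)).
Proof.
move=> u10 u20 w10 w20 u1l u2l w1l w2l.
apply: le_trans (lerD (ler_pM u10 w10 u1l w1l) (ler_pM u20 w20 u2l w2l)) _.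
by rewrite le_eqVlt; apply/orP; left; apply/eqP; ring.
Qed.

(** The product of the midpoint bounds is at most [(u1 + u2) (w1 + w2)], whose mixed part
    [u1 w2 + u2 w1] is at most [N - 2 (N - M) t (1 - t)] by the chords. *)
Lemma mul_midpoint_le_chord (R : realFieldType)
    (t ua ub um wa wb wm u1 u2 w1 w2 : R) :
  0 <= um -> 0 <= wm -> 0 <= u1 -> 0 <= u2 -> 0 <= w1 -> 0 <= w2 ->
  2 * um <= u1 + u2 -> 2 * wm <= w1 + w2 ->
  u1 <= t * ua + (1 - t) * ub -> u2 <= (1 - t) * ua + t * ub ->
  w1 <= t * wa + (1 - t) * wb -> w2 <= (1 - t) * wa + t * wb ->
  4 * um * wm - (ua * wb + ub * wa)
    + 2 * (ua * wb + ub * wa - (ua * wa + ub * wb)) * (t * (1 - t))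
  <= u1 * w1 + u2 * w2.
Proof.
move=> um0 wm0 u10 u20 w10 w20 uml wml u1l u2l w1l w2l.
have um20 : 0 <= 2 * um by lra.
have wm20 : 0 <= 2 * wm by lra.
have := ler_pM um20 wm20 uml wml.
have := lerD (ler_pM u10 w20 u1l w2l) (ler_pM u20 w10 u2l w1l).
lra.
Qed.

(** * Integration of the pointwise bounds *)

Theorem theorem6p1 (R : realType) (a b alpha : R) (u w : R -> R)
    (hab : a < b) (halpha0 : 0 < alpha) (halpha1 : alpha < 1)
    (hu0 : forall x, a <= x <= b -> 0 <= u x)
    (hw0 : forall x, a <= x <= b -> 0 <= w x)
    (hu : convex_function (`[a, b] : set R^o) u)
    (hw : convex_function (`[a, b] : set R^o) w) :
  let rho := (1 - alpha) / alpha * (b - a) in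
  let uw := fun x => u x * w x in
  alpha / (2 * (b - a))
    * (expfrac_left alpha a uw b + expfrac_right alpha b uw a)
  <= (u a * w a + u b * w b)
       * ((rho ^+ 2 - 2 * rho + 4
             - (rho ^+ 2 + 2 * rho + 4) * expR (- rho)) / (2 * rho ^+ 3))
     + (u a * w b + u b * w a)
       * ((rho - 2 + expR (- rho) * (rho + 2)) / rho ^+ 3)
  /\
  2 * u ((a + b) / 2) * w ((a + b) / 2)
  <= (1 - alpha) / (2 * (1 - expR (- rho)))
       * (expfrac_left alpha a uw b + expfrac_right alpha b uw a)
     + (u a * w a + u b * w b)
       * ((rho - 2 + expR (- rho) * (rho + 2))
            / (rho ^+ 2 * (1 - expR (- rho))))
     + (u a * w b + u b * w a)
       * ((rho ^+ 2 - 2 * rho + 4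
             - (rho ^+ 2 + 2 * rho + 4) * expR (- rho))
            / (2 * rho ^+ 2 * (1 - expR (- rho)))).
Proof.
move=> rho uw.
pose c := (1 - alpha) / alpha.
have c0 : 0 < c by rewrite divr_gt0// subr_gt0.
have l0 : 0 < b - a by rewrite subr_gt0.
have rho0 : 0 < rho by rewrite mulr_gt0.
have e1 : expR (- rho) < 1 by rewrite -expR0 ltr_expR; lra.
(* [t s] is the weight of [a] when [s] is written as a convex combination of [a] and [b]; reflection
   exchanges the two weights. *)
pose t s := (b - s) / (b - a).
have t01 s : a <= s <= b -> 0 <= t s <= 1.
  move=> sab; rewrite divr_ge0 ?(ltW l0)//=; last lra.
  by rewrite ler_pdivrMr// mul1r; lra.
have chord (f : R -> R) s : convex_function (`[a, b] : set R^o) f ->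
    a <= s <= b -> f s <= t s * f a + (1 - t s) * f b.
  by move=> cf sab; apply: (convex_function_chord R a b f a b s cf).
have tr s : t (a + b - s) = 1 - t s by rewrite /t; field; rewrite gt_eqF.
have chord' (f : R -> R) s : convex_function (`[a, b] : set R^o) f ->
    a <= s <= b -> f (a + b - s) <= (1 - t s) * f a + t s * f b.
  move=> cf sab; have /= := chord f (a + b - s) cf.
  by rewrite tr subKr; apply; lra.
have mid (f : R -> R) s : convex_function (`[a, b] : set R^o) f ->
    a <= s <= b -> 2 * f ((a + b) / 2) <= f s + f (a + b - s).
  move=> cf sab.
  have := convex_function_ler R a b f s (a + b - s) (1 / 2) cf sab.
  rewrite (_ : _ * _ + _ = (a + b) / 2); last by field.
  lra.
have bound (f : R -> R) s : convex_function (`[a, b] : set R^o) f ->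
    (forall x, a <= x <= b -> 0 <= f x) -> a <= s <= b -> f s <= f a + f b.
  move=> cf f0 sab; apply: le_trans (chord _ _ cf sab) _.
  have fa0 : 0 <= f a by apply: f0; lra.
  have fb0 : 0 <= f b by apply: f0; lra.
  have := t01 _ sab; nra.
(* A crude bound on [uw], used only for integrability. *)
pose K := (u a + u b) * (w a + w b).
have uw0K x : a <= x <= b -> 0 <= uw x <= K.
  move=> xab; rewrite mulr_ge0 ?hu0 ?hw0//= ler_pM ?hu0 ?hw0//; exact: bound.
have muw : measurable_fun `[a, b] uw.
  by apply: measurable_funM; exact: convex_function_measurable.
have refl x : a <= x <= b -> a <= a + b - x <= b by lra.
rewrite (expfrac_left_add_right R a b alpha K uw halpha0 (ltW halpha1) muw uw0K).
set J := \int[_]_(s in _) _.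
pose M := u a * w a + u b * w b.
pose N := u a * w b + u b * w a.
(* [X] and [Y] are the integrals over [[0, 1]] of [exp (- rho x)] and of
   [exp (- rho x) x (1 - x)]. *)
pose X := (1 - expR (- rho)) / rho.
pose Y := (rho - 2 + expR (- rho) * (rho + 2)) / rho ^+ 3.
have iG : lebesgue_measure.-integrable `[a, b]
    (EFin \o (fun s => expR (- c * (s - a)) * (uw s + uw (a + b - s)))).
  apply: (@integrable_expR_mul _ _ _ _ (K + K)); first exact: ltW.
    by apply: measurable_funD => //; exact: measurable_fun_reflect.
  move=> x xab; have /andP[? ?] := uw0K _ xab.
  have /andP[? ?] := uw0K _ (refl _ xab).
  by rewrite ger0_norm ?addr_ge0// lerD.
pose q s := (s - a) / (b - a) * (1 - (s - a) / (b - a)).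
have qE s : q s = t s * (1 - t s) by rewrite /q /t; field; rewrite gt_eqF.
have iq A B : lebesgue_measure.-integrable `[a, b]
    (EFin \o (fun s => expR (- c * (s - a)) * (A + B * q s))).
  apply: (@integrable_expR_mul _ _ _ _ (`|A| + `|B|)); first exact: ltW.
    apply: measurable_funTS; apply: continuous_measurable_fun => s.
    apply/differentiable_continuous/derivable1_diffP.
    by rewrite /q; apply: ex_derive.
  move=> x xab; apply: le_trans (ler_normD _ _) _; rewrite lerD2l normrM.
  rewrite -[leRHS]mulr1 ler_wpM2l// qE.
  by have := t01 _ xab => ?; rewrite ger0_norm; nra.
have Jle : J <= (b - a) * (M * X + 2 * (N - M) * Y).
  rewrite -(@Rintegral_expR_quadratic R a b c)//.
  apply: le_Rintegral => // s; rewrite /= in_itv/= => sab.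
  rewrite ler_wpM2l ?expR_ge0// -/(q s) qE.
  by apply: sum_mul_le_chord; rewrite ?hu0 ?hw0 ?refl ?chord ?chord'.
have leJ : (b - a) * ((4 * u ((a + b) / 2) * w ((a + b) / 2) - N) * X
    + 2 * (N - M) * Y) <= J.
  rewrite -(@Rintegral_expR_quadratic R a b c)//.
  apply: le_Rintegral => // s; rewrite /= in_itv/= => sab.
  rewrite ler_wpM2l ?expR_ge0// -/(q s) qE.
  apply: mul_midpoint_le_chord; rewrite ?hu0 ?hw0 ?refl ?chord ?chord' ?mid//; lra.
(* Halving [M X + 2 (N - M) Y] leaves [X / 2 - Y] as the coefficient of [M] and [Y] as that of
   [N]. *)
have ZE : (rho ^+ 2 - 2 * rho + 4 - (rho ^+ 2 + 2 * rho + 4) * expR (- rho))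
    / (2 * rho ^+ 3) = X / 2 - Y.
  by rewrite /X /Y; field; rewrite gt_eqF.
have X0 : 0 < X by rewrite divr_gt0// subr_gt0.
split.
  rewrite ZE -/Y -/M -/N.
  rewrite (_ : _ * _ = J / (b - a) / 2); last first.
    by field; rewrite !gt_eqF.
  have : J / (b - a) <= M * X + 2 * (N - M) * Y.
    by rewrite ler_pdivrMr// mulrC.
  lra.
have e1' : 1 - expR (- rho) != 0 by rewrite gt_eqF// subr_gt0.
(* Here [(1 - alpha) / alpha = rho / (b - a)] and [1 - exp (- rho) = rho X], so the second
   inequality is half of [leJ] divided by [(b - a) X]. *)
have JE : (1 - alpha) / (2 * (1 - expR (- rho))) * (1 / alpha * J) =
    J / (b - a) / 2 / X.
  move: e1'; rewrite /X; set e := expR _; move=> e1'.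
  rewrite /rho; field.
  by rewrite e1' !gt_eqF// subr_gt0.
have YE : (rho - 2 + expR (- rho) * (rho + 2)) / (rho ^+ 2 * (1 - expR (- rho)))
    = Y / X.
  by rewrite /Y /X; field; rewrite e1' gt_eqF.
have ZE' : (rho ^+ 2 - 2 * rho + 4 - (rho ^+ 2 + 2 * rho + 4) * expR (- rho))
    / (2 * rho ^+ 2 * (1 - expR (- rho))) = (X / 2 - Y) / X.
  by rewrite /Y /X; field; rewrite e1' gt_eqF.
rewrite JE YE ZE' -/M -/N.
have leJ' : (4 * u ((a + b) / 2) * w ((a + b) / 2) - N) * X
    + 2 * (N - M) * Y <= J / (b - a) by rewrite ler_pdivlMr// mulrC.
rewrite [leRHS](_ : _ = (J / (b - a) / 2 + M * Y + N * (X / 2 - Y)) / X).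
  by rewrite ler_pdivlMr//; lra.
by ring.
Qed.
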